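(* Let $(\mathcal{G},X,T)$ be a minimal decomposed graph of groups without circuit, $\Gamma$ its fundamental group and $Z(\Gamma)$ the centre of $\Gamma$. Then one of the following holds: (i) $Z(\Gamma)$ is trivial; (ii) $X$ is reduced to a single vertex $s$ (without edges), and hence $Z(\Gamma)=Z(G_s)$; (iii) $X$ is reduced to one vertex $s$ and one (non-oriented) edge, with $G_s=\{1\}$, and hence $Z(\Gamma)=\Gamma\cong\mathbb{Z}$.
   Context: A finite graph $X$ consists of finite sets $\mathcal{A}_X$ (edges) and $\mathcal{S}_X$ (vertices), a fixed-point-free involution $a\mapsto -a$ of $\mathcal{A}_X$, and maps $\mathrm{o},\mathrm{e}:\mathcal{A}_X\to\mathcal{S}_X$ (origin, end) with $\mathrm{e}(a)=\mathrm{o}(-a)$. A non-oriented edge is a pair $\{a,-a\}$. An orientation is a subset $\mathcal{A}_X^+\subset\mathcal{A}_X$ containing exactly one of $a,-a$ for each $a$. A graph of groups $(\mathcal{G},X)$ is a finite connected oriented graph $X$ with vertex groups $G_s$ ($s\in\mathcal{S}_X$), edge groups $G_a$ ($a\in\mathcal{A}_X^+$), and monomorphisms $f_a:G_a\to G_{\mathrm{o}(a)}$, $f_{-a}:G_a\to G_{\mathrm{e}(a)}$ for $a\in\mathcal{A}_X^+$. A decomposed graph of groups $(\mathcal{G},X,T)$ is a graph of groups together with a maximal tree $T$ of $X$. Its fundamental group $\pi_1(\mathcal{G},X)$ is the quotient of the free product of all $G_s$ and the free group on $\{t_a: a\in\mathcal{A}_X\}$ by the relations $f_a(h)=t_af_{-a}(h)t_a^{-1}$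 ($a\in\mathcal{A}_X^+$, $h\in G_a$), $t_{-a}=t_a^{-1}$ ($a\in\mathcal{A}_X$), $t_a=1$ ($a\in\mathcal{A}_T$). Each $G_s$ embeds naturally in $\pi_1(\mathcal{G},X)$ and is identified with its image (a vertex subgroup). For $a\in\mathcal{A}_X^+$, put $G_a^-=f_a(G_a)\subset G_{\mathrm{o}(a)}$, $G_a^+=f_{-a}(G_a)\subset G_{\mathrm{e}(a)}$ (as subgroups of $\pi_1(\mathcal{G},X)$), and $\varphi_a=f_{-a}\circ f_a^{-1}:G_a^-\to G_a^+$; also $G_{-a}^{\mp}=G_a^{\pm}$ and $\varphi_{-a}=\varphi_a^{-1}$. If $a\in\mathcal{A}_T$ then $G_a^-=G_a^+$, denoted $G_a$. $(\mathcal{G},X,T)$ is minimal if for every edge $a\in\mathcal{A}_T^+$, $G_a$ is a proper subgroup of both $G_{\mathrm{o}(a)}$ and $G_{\mathrm{e}(a)}$. Circuits. Let $u\in G_s$. A circuit at $u$ with origin $s$ consists of: a closed path $(a_1,\dots,a_n)$ in $X$, $n\ge0$, from $s_0=s$ to $s_n=s$ (with $s_i=\mathrm{e}(a_i)=\mathrm{o}(a_{i+1})$ for $0<i<n$; if $n=0$ the path is the single vertex $s$); elements $c_i^-\in G_{a_i}^-$, $c_i^+\in G_{a_i}^+$ with $c_i^+=\varphi_{a_i}(c_i^-)$, $i=1,\dots,n$; and elements $h_i\in G_{s_i}$, $i=0,\dots,n$, such that, if $n=0$, $u=h_0uh_0^{-1}$, and if $n\ge1$, $u=h_0c_1^-h_0^{-1}$,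 $c_i^+=h_ic_{i+1}^-h_i^{-1}$ for $1\le i\le n-1$, and $c_n^+=h_nuh_n^{-1}$. The circuit is trivial if $n=0$. It is reduced if there is no index $1\le i\le n-1$ with $a_{i+1}=-a_i$ and $h_i\in G_{a_i}^+$. The graph of groups is without circuit if for every $u\neq1$ (in a vertex subgroup), every reduced circuit at $u$ is trivial. *)

(* Defs.v *)
From HB Require Import structures.
From mathcomp Require Import all_boot all_algebra.
From mathcomp Require Import boolp classical_sets.

Set Implicit Arguments.
Unset Strict Implicit.
Unset Printing Implicit Defensive.

Local Open Scope quotient_scope.
Local Open Scope classical_set_scope.
Local Open Scope group_scope.

Record graph := Graph {
  edge : finType;
  vertex : finType;
  einv : edge -> edge;
  org : edge -> vertex;
  ter : edge -> vertex;
  einvK : involutive einv;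
  einv_neq : forall a, einv a != a;
  ter_org : forall a, ter a = org (einv a)
}.

Fixpoint walk (X : graph) (E : {set edge X}) (s : vertex X) (p : seq (edge X))
    (s' : vertex X) : bool :=
  if p is a :: p' then [&& a \in E, org a == s & walk E (ter a) p' s']
  else s == s'.

Definition backtrack_free (X : graph) (p : seq (edge X)) : bool :=
  sorted (fun a b => b != einv a) p.

Definition connected_graph (X : graph) : Prop :=
  (exists s : vertex X, True) /\
  forall s s' : vertex X, exists p, walk [set: edge X]%SET s p s'.

Definition is_orientation (X : graph) (P : {set edge X}) : Prop :=
  forall a, (a \in P) (+) (einv a \in P).

Record subgraph (X : graph) := Subgraph {
  sg_vertex : {set vertex X};
  sg_edge : {set edge X};
  sg_einv : forall a, a \in sg_edge -> einv a \in sg_edge;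
  sg_org : forall a, a \in sg_edge -> org a \in sg_vertex
}.

Definition is_subgraph (X : graph) (Y Z : subgraph X) : Prop :=
  (sg_vertex Y \subset sg_vertex Z) /\ (sg_edge Y \subset sg_edge Z).

Definition is_tree (X : graph) (Y : subgraph X) : Prop :=
  [/\ exists s, s \in sg_vertex Y,
      forall s s', s \in sg_vertex Y -> s' \in sg_vertex Y ->
        exists p, walk (sg_edge Y) s p s'
    & forall s p, walk (sg_edge Y) s p s -> backtrack_free p -> p = [::]].

Definition is_maximal_tree (X : graph) (T : subgraph X) : Prop :=
  is_tree T /\ forall Y, is_tree Y -> is_subgraph T Y -> is_subgraph Y T.

Record graph_of_groups := GraphOfGroups {
  gog_graph :> graph;
  gog_connected : connected_graph gog_graph;
  pos_edge : {set edge gog_graph};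
  pos_edgeP : is_orientation pos_edge;
  vgroup : vertex gog_graph -> groupType;
  egroup : {a : edge gog_graph | a \in pos_edge} -> groupType;
  (* the monomorphisms f_a and f_{-a}, for a positive *)
  emb_org : forall a, {multiplicative egroup a -> vgroup (org (val a))};
  emb_ter : forall a, {multiplicative egroup a -> vgroup (ter (val a))};
  emb_org_inj : forall a, injective (emb_org a);
  emb_ter_inj : forall a, injective (emb_ter a)
}.

Record decomposed_gog := DecomposedGog {
  dgog :> graph_of_groups;
  mtree : subgraph dgog;
  mtreeP : is_maximal_tree mtree
}.

(* The fundamental group is given by its presentation: words in the letters
   g (g in a vertex group) and t_a^{+1}, t_a^{-1} (a an edge), modulo the
   smallest congruence containing the multiplication tables of the vertex
   groups, the cancellations t_a t_a^{-1} = t_a^{-1} t_a = 1, and the three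
   families of defining relations. *)
Section FundamentalGroup.
Variable G : decomposed_gog.

Definition letter : choiceType := ({s : vertex G & vgroup s} + edge G * bool)%type.
Definition word : choiceType := seq letter.

Definition lv (s : vertex G) (g : vgroup s) : letter := inl (Tagged (fun s => vgroup s) g).
(* [lt a true] is t_a and [lt a false] is its inverse *)
Definition lt (a : edge G) (b : bool) : letter := inr (a, b).

Inductive word_eq : word -> word -> Prop :=
| weq_refl w : word_eq w w
| weq_sym v w : word_eq v w -> word_eq w v
| weq_trans u v w : word_eq u v -> word_eq v w -> word_eq u w
| weq_cat v v' w w' : word_eq v v' -> word_eq w w' ->
    word_eq (v ++ w) (v' ++ w')
| weq_one s : word_eq [:: lv (1 : vgroup s)] [::]
| weq_mul s (g h : vgroup s) : word_eq [:: lv g; lv h] [:: lv (g * h)]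
| weq_cancel a b : word_eq [:: lt a b; lt a (~~ b)] [::]
| weq_edge a (h : egroup a) :
    word_eq [:: lv (emb_org a h)]
            [:: lt (val a) true; lv (emb_ter a h); lt (val a) false]
| weq_einv a : word_eq [:: lt (einv a) true] [:: lt a false]
| weq_tree a : a \in sg_edge (mtree G) -> word_eq [:: lt a true] [::].

Definition word_eqb (v w : word) : bool := `[< word_eq v w >].

Lemma word_eqb_refl : reflexive word_eqb.
Proof. by move=> w; apply/asboolP/weq_refl. Qed.

Lemma word_eqb_sym : symmetric word_eqb.
Proof. by move=> v w; apply/asboolP/asboolP; apply: weq_sym. Qed.

Lemma word_eqb_trans : transitive word_eqb.
Proof. by move=> v u w /asboolP uv /asboolP vw; apply/asboolP/(weq_trans uv). Qed.

Canonical word_equiv :=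
  EquivRel word_eqb word_eqb_refl word_eqb_sym word_eqb_trans.

Definition pi1 : Type := {eq_quot word_equiv}.
HB.instance Definition _ := Choice.on pi1.
HB.instance Definition _ := EqQuotient.on pi1.

Definition pi1_of_word (w : word) : pi1 := \pi_pi1 w.

Lemma pi1_eqP v w : pi1_of_word v = pi1_of_word w <-> word_eq v w.
Proof.
split=> [/eqP|vw]; first by rewrite /pi1_of_word eqmodE => /asboolP.
by apply/eqP; rewrite /pi1_of_word eqmodE; apply/asboolP.
Qed.

Lemma repr_word_eq w : word_eq (repr (pi1_of_word w)) w.
Proof. by apply/pi1_eqP; rewrite /pi1_of_word reprK. Qed.

Definition inv_letter (x : letter) : letter :=
  match x with
  | inl g => lv (tagged g)^-1
  | inr (a, b) => lt a (~~ b)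
  end.
Definition inv_word (w : word) : word := rev (map inv_letter w).

Definition pi1_one : pi1 := pi1_of_word [::].
Definition pi1_mul (x y : pi1) : pi1 := pi1_of_word (repr x ++ repr y).
Definition pi1_inv (x : pi1) : pi1 := pi1_of_word (inv_word (repr x)).

Lemma inv_letterK x : word_eq [:: x; inv_letter x] [::].
Proof.
case: x => [[s g]|[a b]] /=; last exact: weq_cancel.
by apply: (weq_trans (weq_mul _ _)); rewrite mulgV; apply: weq_one.
Qed.

Lemma inv_letterVK x : word_eq [:: inv_letter x; x] [::].
Proof.
case: x => [[s g]|[a b]] /=.
  by apply: (weq_trans (weq_mul _ _)); rewrite mulVg; apply: weq_one.
by have := weq_cancel a (~~ b); rewrite negbK.
Qed.

Lemma inv_wordK w : word_eq (w ++ inv_word w) [::].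
Proof.
elim: w => [|x w IH]; first exact: weq_refl.
rewrite /inv_word map_cons rev_cons -cats1 /= -/(inv_word w) catA.
apply: weq_trans (inv_letterK x).
apply: (@weq_cat [:: x] [:: x] _ [:: inv_letter x]); first exact: weq_refl.
exact: (weq_cat IH (weq_refl _)).
Qed.

Lemma inv_wordVK w : word_eq (inv_word w ++ w) [::].
Proof.
elim: w => [|x w IH]; first exact: weq_refl.
rewrite /inv_word map_cons rev_cons -cats1 -/(inv_word w) -catA.
apply: weq_trans IH.
apply: weq_cat (weq_refl _) _.
exact: (weq_cat (inv_letterVK x) (weq_refl w)).
Qed.

Lemma pi1_mulA : associative pi1_mul.
Proof.
move=> x y z; apply/pi1_eqP.
apply: weq_trans (weq_cat (weq_refl _) (repr_word_eq _)) _.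
rewrite catA; apply: weq_sym.
exact: weq_cat (repr_word_eq _) (weq_refl _).
Qed.

Lemma pi1_of_word_repr (x : pi1) : pi1_of_word (repr x) = x.
Proof. exact: reprK. Qed.

Lemma pi1_mul1 : left_id pi1_one pi1_mul.
Proof.
move=> x; rewrite -[RHS]pi1_of_word_repr; apply/pi1_eqP.
exact: weq_cat (repr_word_eq [::]) (weq_refl _).
Qed.

Lemma pi1_1mul : right_id pi1_one pi1_mul.
Proof.
move=> x; rewrite -[RHS]pi1_of_word_repr; apply/pi1_eqP.
rewrite -[X in word_eq _ X]cats0.
exact: weq_cat (weq_refl _) (repr_word_eq [::]).
Qed.

Lemma pi1_mulV : left_inverse pi1_one pi1_inv pi1_mul.
Proof.
move=> x; apply/pi1_eqP; apply: weq_trans (inv_wordVK (repr x)).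
exact: weq_cat (repr_word_eq _) (weq_refl _).
Qed.

Lemma pi1_Vmul : right_inverse pi1_one pi1_inv pi1_mul.
Proof.
move=> x; apply/pi1_eqP; apply: weq_trans (inv_wordK (repr x)).
exact: weq_cat (weq_refl _) (repr_word_eq _).
Qed.

HB.instance Definition _ := isGroup.Build pi1
  pi1_mulA pi1_mul1 pi1_1mul pi1_mulV pi1_Vmul.

(* the natural map G_s -> pi_1, by which G_s is identified with its image *)
Definition vincl (s : vertex G) (g : vgroup s) : pi1 := pi1_of_word [:: lv g].

Definition vsubgroup (s : vertex G) : set pi1 := range (@vincl s).

(* The graph of phi_a : G_a^- -> G_a^+, for an arbitrary edge a.  If a is
   positive this is f_{-a} o f_a^-1; if a = -b with b positive it is the
   inverse of phi_b. *)
Definition edge_iso (a : edge G) (x y : pi1) : Prop :=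
  (exists2 b : {b : edge G | b \in pos_edge G}, val b = a &
     exists h : egroup b, x = vincl (emb_org b h) /\ y = vincl (emb_ter b h)) \/
  (exists2 b : {b : edge G | b \in pos_edge G}, val b = einv a &
     exists h : egroup b, x = vincl (emb_ter b h) /\ y = vincl (emb_org b h)).

(* the subgroups G_a^- of G_{o(a)} and G_a^+ of G_{e(a)} *)
Definition edge_sub_org (a : edge G) : set pi1 := [set x | exists y, edge_iso a x y].
Definition edge_sub_ter (a : edge G) : set pi1 := [set y | exists x, edge_iso a x y].

(* For an edge a of the maximal tree the two subgroups G_a^- and G_a^+
   coincide; G_a is rendered by the former. *)
Definition minimal_dgog : Prop :=
  forall a, a \in sg_edge (mtree G) -> a \in pos_edge G ->
    edge_sub_org a `<` vsubgroup (org a) /\ edge_sub_org a `<` vsubgroup (ter a).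

(* The edges a_1, ..., a_n and the elements c_1^-/+, ..., c_n^-/+ are indexed
   from 0: a_(i+1) is [ct_edge i] for i : 'I_n.  The vertices s_0, ..., s_n and
   the elements h_0, ..., h_n keep their indices; for i : 'I_n, [lift ord0 i]
   is the index i+1 in 'I_n.+1. *)
Record circuit (s : vertex G) (u : pi1) := Circuit {
  ct_len : nat;
  ct_edge : 'I_ct_len -> edge G;
  ct_vertex : 'I_ct_len.+1 -> vertex G;
  ct_cm : 'I_ct_len -> pi1;
  ct_cp : 'I_ct_len -> pi1;
  ct_h : 'I_ct_len.+1 -> pi1;
  ct_first : ct_vertex ord0 = s;
  ct_last : ct_vertex ord_max = s;
  ct_org : forall i : 'I_ct_len,
    org (ct_edge i) = ct_vertex (widen_ord (leqnSn _) i);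
  ct_ter : forall i : 'I_ct_len, ter (ct_edge i) = ct_vertex (lift ord0 i);
  ct_cmP : forall i, edge_sub_org (ct_edge i) (ct_cm i);
  ct_cpP : forall i, edge_sub_ter (ct_edge i) (ct_cp i);
  ct_iso : forall i, edge_iso (ct_edge i) (ct_cm i) (ct_cp i);
  ct_hP : forall i, vsubgroup (ct_vertex i) (ct_h i);
  ct_eq0 : ct_len = 0%N -> u = ct_h ord0 * u * (ct_h ord0)^-1;
  ct_eq_first : forall i : 'I_ct_len, i = 0%N :> nat ->
    u = ct_h ord0 * ct_cm i * (ct_h ord0)^-1;
  ct_eq_mid : forall i j : 'I_ct_len, j = i.+1 :> nat ->
    ct_cp i = ct_h (lift ord0 i) * ct_cm j * (ct_h (lift ord0 i))^-1;
  ct_eq_last : forall i : 'I_ct_len, i.+1 = ct_len ->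
    ct_cp i = ct_h ord_max * u * (ct_h ord_max)^-1
}.

Definition trivial_circuit s u (c : circuit s u) : Prop := ct_len c = 0%N.

Definition reduced_circuit s u (c : circuit s u) : Prop :=
  ~ exists i j : 'I_(ct_len c), [/\ j = i.+1 :> nat,
      ct_edge j = einv (ct_edge i)
    & edge_sub_ter (ct_edge i) (ct_h (lift ord0 i))].

Definition without_circuit : Prop :=
  forall (s : vertex G) (u : pi1), vsubgroup s u -> u <> 1 ->
  forall c : circuit s u, reduced_circuit c -> trivial_circuit c.

End FundamentalGroup.

Definition center (H : groupType) : set H := [set z | forall x, commute z x].
Arguments center : clear implicits.

Definition isomorphic_to_Z (H : groupType) : Prop :=
  exists2 f : int -> H, bijective f & forall m n : int, f (m + n)%R = f m * f n.

(* Main.v *)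
Require Import Defs.
From HB Require Import structures.
From mathcomp Require Import all_boot all_algebra.
From mathcomp Require Import boolp classical_sets.

(** The absence of circuits says that centralizers are local: if [u <> 1] lies
    in a vertex group [G_s], then everything commuting with [u] lies in [G_s]
    ([centralizer_in_vsubgroup]).  Indeed an element [z] of the fundamental
    group [Gamma] can be written as a reduced expression
    [h_0 t_(a_1) h_1 ... t_(a_n) h_n] along a closed path at [s]
    ([closed_path_exists]); if [u z = z u], the two reduced expressions of this
    element differ only by elements of the edge groups slid along the path, and
    the slid elements are the [c_i] of a reduced circuit at [u]
    ([commuting_path_trivial]), so [n = 0].

    Let [z <> 1] be central.  If some vertex group contains [u <> 1], then [z]
    is in [G_s]; as everything commutes with [z], [Gamma = G_s] and no nonempty
    closed path at [s] carries a reduced expression.  But every edge with origin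
    [s] starts such a path ([nontrivial_closed_path]): an edge outside the maximal
    tree is closed up inside the tree, and an edge [a] of the tree is followed
    by [-a], with an element of the far vertex group outside [G_a] in between,
    which minimality provides.  So no edge starts at [s], and by connectedness
    there is neither another vertex nor an edge.  If all vertex groups are
    trivial, minimality forbids edges in the maximal tree, there is a single
    vertex, and [Gamma] is free on the non-oriented edges: its centre is trivial
    in rank at least 2 ([free_centre]), and it is infinite cyclic in rank 1
    ([cyclic_case]).

    Both the uniqueness of reduced expressions ([pi1_ladder]) and the embedding
    of the vertex groups ([vincl_inj]) come from mapping [Gamma] to a group [K]
    containing an HNN extension of a single group [H], with one stable letter
    [theta a] per edge.  Such a map needs no [theta a] to be trivial: if [tau s]
    is the product of the stable letters along the tree path from a base vertex
    to [s], then [g] in [G_s] goes to [tau s * g * (tau s)^-1] and [t_a] to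
    [tau (org a) * theta a * (tau (ter a))^-1], which is [1] for [a] in the tree
    ([pi1_lift]).  An expression along a path from [s] to [t] therefore goes to
    the same expression in [K], between [tau s] and [(tau t)^-1], and the normal
    form theorem for HNN extensions ([hnn_ladder]) applies.  With [H] the
    product of the vertex groups this yields the embedding; with [H = Gamma]
    itself, whose subgroups [G_a^-] and [G_a^+] are conjugate under [t_a], it
    yields the statement on reduced expressions directly in the terms in which
    circuits are defined. *)

Set Implicit Arguments.
Unset Strict Implicit.
Unset Printing Implicit Defensive.

Local Open Scope group_scope.

(** * Groups of bijections and products of groups *)

(** The inverse is part of the data, so that inverting needs no choice; it is
    determined by the function, hence equality is pointwise. *)
Record bijection (T : Type) := Bijection {
  bij_fun :> T -> T;
  bij_inv : T -> T;
  bij_funK : cancel bij_fun bij_inv;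
  bij_invK : cancel bij_inv bij_fun
}.

Section BijectionGroup.
Variable T : Type.
Implicit Types f g : bijection T.

HB.instance Definition _ := gen_eqMixin (bijection T).
HB.instance Definition _ := gen_choiceMixin (bijection T).

Lemma bijection_eq f g : f =1 g -> f = g.
Proof.
case: f g => f f' fK f'K [g g' gK g'K] /= fg.
have fgE : f = g by apply: funext.
have fgE' : f' = g' by apply: funext => x; rewrite -{1}[x]g'K -fg fK.
by case: g / fgE gK g'K fg; case: g' / fgE' => *; congr Bijection.
Qed.

Definition bijection_one : bijection T := @Bijection T id id (frefl _) (frefl _).
Definition bijection_mul f g : bijection T :=
  Bijection (can_comp (bij_funK f) (bij_funK g))
            (can_comp (bij_invK g) (bij_invK f)).
Definition bijection_inv f : bijection T := Bijection (bij_invK f) (bij_funK f).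

Lemma bijection_mulA : associative bijection_mul.
Proof. by move=> f g h; apply: bijection_eq. Qed.
Lemma bijection_mul1 : left_id bijection_one bijection_mul.
Proof. by move=> f; apply: bijection_eq. Qed.
Lemma bijection_1mul : right_id bijection_one bijection_mul.
Proof. by move=> f; apply: bijection_eq. Qed.
Lemma bijection_mulV : left_inverse bijection_one bijection_inv bijection_mul.
Proof. by move=> f; apply: bijection_eq => x; apply: bij_funK. Qed.
Lemma bijection_Vmul : right_inverse bijection_one bijection_inv bijection_mul.
Proof. by move=> f; apply: bijection_eq => x; apply: bij_invK. Qed.

HB.instance Definition _ := isGroup.Build (bijection T) bijection_mulA
  bijection_mul1 bijection_1mul bijection_mulV bijection_Vmul.

Lemma bijectionM f g x : (f * g) x = f (g x).
Proof. by []. Qed.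

End BijectionGroup.

Definition group_product (I : Type) (T : I -> groupType) : Type := forall i, T i.

Section GroupProduct.
Variables (I : eqType) (T : I -> groupType).
Local Notation P := (group_product T).
Implicit Types f g : P.

HB.instance Definition _ := gen_eqMixin P.
HB.instance Definition _ := gen_choiceMixin P.

Definition product_mul f g : P := fun i => f i * g i.
Definition product_one : P := fun i => 1.
Definition product_inv f : P := fun i => (f i)^-1.

Lemma product_mulA : associative product_mul.
Proof. by move=> f g h; apply: functional_extensionality_dep => i; apply: mulgA. Qed.
Lemma product_mul1 : left_id product_one product_mul.
Proof. by move=> f; apply: functional_extensionality_dep => i; apply: mul1g. Qed.
Lemma product_1mul : right_id product_one product_mul.
Proof. by move=> f; apply: functional_extensionality_dep => i; apply: mulg1. Qed.
Lemma product_mulV : left_inverse product_one product_inv product_mul.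
Proof. by move=> f; apply: functional_extensionality_dep => i; apply: mulVg. Qed.
Lemma product_Vmul : right_inverse product_one product_inv product_mul.
Proof. by move=> f; apply: functional_extensionality_dep => i; apply: mulgV. Qed.

HB.instance Definition _ := isGroup.Build P product_mulA
  product_mul1 product_1mul product_mulV product_Vmul.

Lemma productM f g i : (f * g) i = f i * g i.
Proof. by []. Qed.

(** Through this map all vertex groups become subgroups of one group, so that
    expressions can take all their elements in a single type. *)
Definition product_incl (i : I) (x : T i) : P := @dfwith I T (fun=> 1) i x.

Lemma product_inclM i : {morph @product_incl i : x y / x * y}.
Proof.
move=> x y; apply: functional_extensionality_dep => j.
rewrite productM /product_incl; have [<-|ij] := eqVneq i j.
  by rewrite !dfwith_in.
by rewrite !dfwith_out// mulg1.
Qed.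

Lemma product_incl_inj i : injective (@product_incl i).
Proof. by move=> x y /(congr1 (fun f : P => f i)); rewrite /product_incl !dfwith_in. Qed.

End GroupProduct.

(** * HNN extensions with several stable letters *)

(** [PStep h a p] stands for [h * t_a * p] and [PEnd g] for [g]. *)
Inductive path_word (H E : Type) :=
| PEnd of H
| PStep of H & E & path_word H E.
Arguments PEnd {H E}.
Arguments PStep {H E}.

Fixpoint path_size H E (p : path_word H E) : nat :=
  if p is PStep _ _ q then (path_size q).+1 else 0.

Fixpoint path_val (H E : Type) (K : groupType) (eta : H -> K) (theta : E -> K)
    (p : path_word H E) : K :=
  match p with
  | PEnd g => eta g
  | PStep h a q => eta h * theta a * path_val eta theta q
  end.

(** [R a] is the graph of an isomorphism between two subgroups of [H] and
    [R (inv a)] that of its inverse: the data of an HNN extension of [H] with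
    stable letters [t_a], where [t_(inv a) = t_a^-1], and relations
    [x t_a = t_a y] for [R a x y]. *)
Record partial_isos (H : groupType) (E : Type) (inv : E -> E)
    (R : E -> H -> H -> Prop) : Prop := PartialIsos {
  pisoK : involutive inv;
  piso_sym : forall a x y, R a x y -> R (inv a) y x;
  piso_one : forall a, R a 1 1;
  piso_mul : forall a x y x' y', R a x y -> R a x' y' -> R a (x * x') (y * y');
  piso_inv : forall a x y, R a x y -> R a x^-1 y^-1;
  piso_fun : forall a x y y', R a x y -> R a x y' -> y = y'
}.

Section HNN.
Variables (H : groupType) (E : eqType) (inv : E -> E) (R : E -> H -> H -> Prop).
Local Notation path := (path_word H E).
Implicit Types (a b : E) (h k x y u : H) (p q : path).

Definition edge_dom a x := exists y, R a x y.

(** Excludes [t_a h t_(inv a)] with [h = y] for some [R a x y], a product which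
    equals [x]. *)
Definition no_cancel a p :=
  if p is PStep h b _ then ~ (b = inv a /\ edge_dom b h) else True.

Fixpoint reduced p :=
  if p is PStep _ a q then no_cancel a q /\ reduced q else True.

(** The reason why [u * p] and [q] have the same value: the expressions run
    through the same stable letters, and [u] slides along them from left to right,
    crossing each stable letter by means of a relation [c t_a = t_a d]. *)
Fixpoint ladder u p q : Prop :=
  match p, q with
  | PEnd g, PEnd g' => u * g = g'
  | PStep h a p', PStep h' a' q' =>
    a = a' /\ exists c d, [/\ R a c d, u * h = h' * c & ladder d p' q']
  | _, _ => False
  end.

Hypothesis RP : partial_isos inv R.

Lemma edge_dom1 a : edge_dom a 1.
Proof. by exists 1; apply: (piso_one RP). Qed.

Lemma edge_domM a x y : edge_dom a x -> edge_dom a y -> edge_dom a (x * y).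
Proof. by move=> [x' xx'] [y' yy']; exists (x' * y'); apply: (piso_mul RP xx' yy'). Qed.

Lemma edge_domV a x : edge_dom a x -> edge_dom a x^-1.
Proof. by move=> [x' xx']; exists x'^-1; apply: (piso_inv RP xx'). Qed.

Lemma edge_domMl a x y : edge_dom a x -> edge_dom a (x * y) -> edge_dom a y.
Proof. by move=> /edge_domV ax axy; rewrite -[y](mulKg x); apply: edge_domM. Qed.

Definition edge_map a x : H :=
  if pselect (edge_dom a x) is left e then projT1 (cid e) else 1.

Lemma edge_mapP a x : edge_dom a x -> R a x (edge_map a x).
Proof. by rewrite /edge_map; case: pselect => // e _; case: cid. Qed.

Lemma edge_map_eq a x y : R a x y -> edge_map a x = y.
Proof.
move=> Ra; have ax : edge_dom a x by exists y.
exact: (piso_fun RP (edge_mapP ax) Ra).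
Qed.

Lemma edge_mapM a x y : edge_dom a x -> edge_dom a y ->
  edge_map a (x * y) = edge_map a x * edge_map a y.
Proof.
by move=> ax ay; apply/edge_map_eq/(piso_mul RP); apply: edge_mapP.
Qed.

Lemma edge_map_dom a x : edge_dom a x -> edge_dom (inv a) (edge_map a x).
Proof. by move=> /edge_mapP/(piso_sym RP); exists x. Qed.

(** Chooses an element in each left coset of the domain of [R a], and [1] in
    the domain itself; being canonical, it depends only on the coset. *)
Definition coset_rep a x : H :=
  if `[< edge_dom a x >] then 1
  else choose (fun r => `[< edge_dom a (r^-1 * x) >]) x.

Lemma coset_repP a x : edge_dom a ((coset_rep a x)^-1 * x).
Proof.
rewrite /coset_rep; case: asboolP => [ax|_]; first by rewrite invg1 mul1g.
apply/(@asboolP (edge_dom a (_^-1 * x))).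
apply: (@chooseP _ (fun r => `[< edge_dom a (r^-1 * x) >])).
by apply/asboolP; rewrite mulVg; apply: edge_dom1.
Qed.

Lemma coset_rep_id1 a x : edge_dom a x -> coset_rep a x = 1.
Proof. by rewrite /coset_rep; case: asboolP. Qed.

Lemma coset_rep_eq1 a x : coset_rep a x = 1 -> edge_dom a x.
Proof. by move=> r1; have := coset_repP a x; rewrite r1 invg1 mul1g. Qed.

Lemma coset_repM a x y : edge_dom a y -> coset_rep a (x * y) = coset_rep a x.
Proof.
move=> ay; have axyE z : edge_dom a (z * (x * y)) <-> edge_dom a (z * x).
  split=> [azxy|azx]; last by rewrite mulgA; apply: edge_domM.
  by rewrite -[x](mulgK y) mulgA; apply: edge_domM azxy (edge_domV ay).
rewrite /coset_rep (_ : `[< edge_dom a (x * y) >] = `[< edge_dom a x >]); last first.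
  by have := axyE 1; rewrite !mul1g => axy; apply/asboolP/asboolP => /axy.
case: asboolP => // _.
have eqP : (fun r => `[< edge_dom a (r^-1 * (x * y)) >]) =1
           (fun r => `[< edge_dom a (r^-1 * x) >]).
  by move=> r; apply/asboolP/asboolP => /axyE.
rewrite (eq_choose eqP); apply: choose_id; apply/asboolP; last first.
  by rewrite mulVg; apply: edge_dom1.
by rewrite invgM mulgVK; apply: edge_domV.
Qed.

Lemma coset_rep_id a x : coset_rep a (coset_rep a x) = coset_rep a x.
Proof.
by rewrite -{2}[x](mulVKg (coset_rep a x)) coset_repM //; apply: coset_repP.
Qed.

Lemma coset_rep_dom a x : edge_dom a (coset_rep a x) -> edge_dom a x.
Proof. by move=> /coset_rep_id1; rewrite coset_rep_id => /coset_rep_eq1. Qed.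

(** Normal forms: reduced expressions in which the element before each stable
    letter is the chosen representative of its coset.  Every element of the HNN
    extension has exactly one, so the left translations by [h] and by [t_a] can
    be written as the operations [base_act h] and [stable_act a] below; the
    extension is thus realised among the bijections of the set of normal forms,
    without any presentation. *)
Fixpoint normal p :=
  if p is PStep c a q then [/\ coset_rep a c = c, no_cancel a q & normal q]
  else True.

Fixpoint base_act h p : path :=
  match p with
  | PEnd g => PEnd (h * g)
  | PStep c a q => let r := coset_rep a (h * c) in
      PStep r a (base_act (edge_map a (r^-1 * (h * c))) q)
  end.

Definition stable_act a p : path :=
  match p with
  | PStep c b q => if (b == inv a) && (c == 1) then q else PStep 1 a p
  | PEnd _ => PStep 1 a p
  end.

Lemma no_cancel_base_act a h p :
  edge_dom (inv a) h -> no_cancel a p -> no_cancel a (base_act h p).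
Proof.
case: p => [//|c b q] /= ah ncp [ba bc]; apply: ncp; split=> //.
by move/coset_rep_dom: bc; apply: edge_domMl; rewrite ba.
Qed.

Lemma normal_base_act h p : normal p -> normal (base_act h p).
Proof.
elim: p h => [//|c a q IHq] h /= [ac ncq nq]; split; last exact: IHq.
  exact: coset_rep_id.
by apply: no_cancel_base_act => //; apply/edge_map_dom/coset_repP.
Qed.

Lemma base_act1 p : normal p -> base_act 1 p = p.
Proof.
elim: p => [g|c a q IHq] /=; first by rewrite mul1g.
move=> [ac ncq nq]; rewrite mul1g ac mulVg (edge_map_eq (piso_one RP a)).
by rewrite IHq.
Qed.

Lemma base_actM h k p : base_act (h * k) p = base_act h (base_act k p).
Proof.
elim: p h k => [g|c a q IHq] h k /=; first by rewrite mulgA.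
set r := coset_rep a (k * c); set b := r^-1 * (k * c).
have ab : edge_dom a b := coset_repP a (k * c).
have kcE : h * k * c = h * r * b by rewrite /b -!mulgA mulVKg.
rewrite kcE coset_repM // mulgA edge_mapM ?IHq //.
exact: coset_repP.
Qed.

Lemma normal_stable_act a p : normal p -> normal (stable_act a p).
Proof.
case: p => [g|c b q] /=; first by rewrite coset_rep_id1 //; apply: edge_dom1.
move=> [bc ncq nq]; case: ifP => // /negbT ba.
split=> //; first by rewrite coset_rep_id1 //; apply: edge_dom1.
move=> [bE bdc]; move: ba; rewrite bE eqxx -bc coset_rep_id1 ?eqxx //.
Qed.

Lemma stable_actK a p : normal p -> stable_act a (stable_act (inv a) p) = p.
Proof.
case: p => [g|c b q] /=; first by rewrite !eqxx.
rewrite (pisoK RP); case: ifP => [/andP[/eqP-> /eqP->]|_] /=; last by rewrite !eqxx.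
case: q => [//|c' b' q'] [_ /= ncq _].
case: ifP => // /andP[/eqP b'E /eqP c'E]; case: ncq; split=> //.
by rewrite c'E; apply: edge_dom1.
Qed.

Lemma base_stable_act a x y p : R a x y -> normal p ->
  base_act x (stable_act a p) = stable_act a (base_act y p).
Proof.
move=> Rxy np; have ax : edge_dom a x by exists y.
have ay : edge_dom (inv a) y by exists x; apply: (piso_sym RP).
have stepE q : base_act x (PStep 1 a q) = PStep 1 a (base_act y q).
  by rewrite /= mulg1 coset_rep_id1 // invg1 mul1g (edge_map_eq Rxy).
case: p np => [g|c b q]; first by rewrite stepE.
move=> [bc ncq nq]; rewrite {1}/stable_act.
case: ifP => [/andP[/eqP bE /eqP c1]|bN].
  rewrite bE c1 /= mulg1 coset_rep_id1 // !eqxx invg1 mul1g.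
  by rewrite (edge_map_eq (piso_sym RP Rxy)).
rewrite stepE /=; case: ifP => // /andP[/eqP bE /eqP/coset_rep_eq1 byc].
have /coset_rep_id1 : edge_dom b c by apply: edge_domMl byc; rewrite bE.
by rewrite bc => c1; rewrite bE c1 !eqxx in bN.
Qed.

Definition normal_form := {p : path | normal p}.

Lemma normal_form_eq (x y : normal_form) : sval x = sval y -> x = y.
Proof. by case: x y => x nx [y ny] /= xy; apply: eq_exist. Qed.

Definition base_nf h (x : normal_form) : normal_form :=
  exist _ (base_act h (sval x)) (normal_base_act h (svalP x)).
Definition stable_nf a (x : normal_form) : normal_form :=
  exist _ (stable_act a (sval x)) (normal_stable_act a (svalP x)).

Lemma base_nfK h : cancel (base_nf h) (base_nf h^-1).
Proof.
move=> x; apply: normal_form_eq; rewrite /= -base_actM mulVg base_act1 //.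
exact: svalP.
Qed.

Lemma base_nfVK h : cancel (base_nf h^-1) (base_nf h).
Proof. by move=> x; rewrite -{1}[h]invgK base_nfK. Qed.

Lemma stable_nfVK a : cancel (stable_nf (inv a)) (stable_nf a).
Proof. by move=> x; apply/normal_form_eq/stable_actK/svalP. Qed.

Lemma stable_nfK a : cancel (stable_nf a) (stable_nf (inv a)).
Proof. by move=> x; rewrite -{2}[a](pisoK RP) stable_nfVK. Qed.

Definition hnn_base h : bijection normal_form := Bijection (base_nfK h) (base_nfVK h).
Definition hnn_stable a : bijection normal_form :=
  Bijection (stable_nfK a) (stable_nfVK a).

Lemma hnn_baseM : {morph hnn_base : h k / h * k}.
Proof.
by move=> h k; apply: bijection_eq => x; apply/normal_form_eq/base_actM.
Qed.

Lemma hnn_stableV a : hnn_stable (inv a) = (hnn_stable a)^-1.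
Proof. exact: bijection_eq. Qed.

Lemma hnn_relation a x y : R a x y ->
  hnn_base x * hnn_stable a = hnn_stable a * hnn_base y.
Proof.
move=> Rxy; apply: bijection_eq => z; apply: normal_form_eq.
by rewrite /=; apply: base_stable_act => //; apply: svalP.
Qed.

Definition base_point : normal_form := exist normal (PEnd 1) I.

Local Notation hval := (path_val hnn_base hnn_stable).

(** If [t_a] cancelled the first stable letter of the normal form of [q], the
    first element of [q] would lie in the domain of [R (inv a)], against reducedness. *)
Lemma stable_act_val h a q : reduced (PStep h a q) ->
  stable_act a (sval (hval q base_point)) = PStep 1 a (sval (hval q base_point)).
Proof.
elim: q a h => [g|h' b q IHq] a h [nc rq] //=.
rewrite (IHq b h') //= mulg1; case: ifP => // /andP[/eqP ba /eqP b1].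
by case: nc; split=> //; apply: coset_rep_eq1.
Qed.

Lemma hnn_val_step h a q : reduced (PStep h a q) ->
  sval (hval (PStep h a q) base_point) =
    base_act h (PStep 1 a (sval (hval q base_point))).
Proof. by move=> rq /=; rewrite (stable_act_val rq). Qed.

(** Acting on the empty normal form, the reduced expression [PStep h a p] gives
    a normal form that starts with the representative of the coset of [h],
    followed by [a].  So if [p] and [q] start with [h t_a] and [h' t_(a')], then
    [a = a'], the elements [u h] and [h'] have the same representative, and
    [h'^-1 u h] is in the domain of [R a]; it can be slid across [t_a], and the
    argument repeats with what remains. *)
Theorem hnn_ladder u p q : reduced p -> reduced q ->
  hnn_base u * hval p = hval q -> ladder u p q.
Proof.
move=> rp rq /(congr1 (fun f : bijection _ => sval (f base_point))).
rewrite bijectionM [LHS]/=.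
elim: p u q rp rq => [g|h a p IHp] u q rp rq.
  case: q rq => [g'|h' a' q] rq; last by rewrite hnn_val_step.
  by rewrite /= !mulg1 => -[].
rewrite hnn_val_step // -base_actM.
case: q rq => [g'|h' a' q] rq //; rewrite hnn_val_step // => eq_pq.
have ea : a = a' by case: eq_pq.
split=> //; case: a' / ea rq eq_pq => rq /(congr1 (base_act h'^-1)).
rewrite -!base_actM mulVg base_act1; last first.
  rewrite -(stable_act_val rq); apply/normal_stable_act/svalP.
rewrite mulgA /= mulg1 => -[/coset_rep_eq1 dom_c].
rewrite coset_rep_id1 // invg1 mul1g => /(IHp _ _ (proj2 rp) (proj2 rq)) lad.
exists (h'^-1 * u * h), (edge_map a (h'^-1 * u * h)).
split=> //; first exact: edge_mapP.
by rewrite -!mulgA mulVKg.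
Qed.

End HNN.

(** * Walks and maximal trees *)

Section Walks.
Variable X : graph.
Implicit Types (a b : edge X) (s t r : vertex X) (p q : seq (edge X))
  (E : {set edge X}).

Lemma org_einv a : org (einv a) = ter a.
Proof. by rewrite ter_org. Qed.

Lemma ter_einv a : ter (einv a) = org a.
Proof. by rewrite ter_org einvK. Qed.

Lemma walk_cat E s r p q : walk E s (p ++ q) r ->
  exists2 t, walk E s p t & walk E t q r.
Proof.
elim: p s => [|a p IHp] s /=; first by exists s.
by case/and3P=> -> -> /IHp[t pt tr]; exists t.
Qed.

Lemma cat_walk E s t r p q : walk E s p t -> walk E t q r -> walk E s (p ++ q) r.
Proof.
elim: p s => [|a p IHp] s /=; first by move=> /eqP->.
by case/and3P=> -> -> /IHp/[apply].
Qed.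

Definition rev_walk p := rev (map (@einv X) p).

Lemma walk_rev E s t p : (forall a, a \in E -> einv a \in E) ->
  walk E s p t -> walk E t (rev_walk p) s.
Proof.
move=> symE; elim: p s => [|a p IHp] s /=; first by rewrite eq_sym.
case/and3P=> aE /eqP <- /IHp wp; rewrite /rev_walk /= rev_cons -cats1.
by apply: cat_walk wp _; rewrite /= symE // org_einv ter_einv !eqxx.
Qed.

Lemma walk_sub E E' s t p : {subset E <= E'} -> walk E s p t -> walk E' s p t.
Proof.
move=> EE'; elim: p s => [//|a p IHp] s /= /and3P[/EE'-> -> /IHp->] //.
Qed.

Lemma backtrackP p : ~~ backtrack_free p ->
  exists p1 a p2, p = p1 ++ a :: einv a :: p2.
Proof.
elim: p => [//|a [//|b p] IHp]; rewrite /backtrack_free /= negb_and negbK.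
case/orP=> [/eqP->|/IHp[p1 [c [p2 ->]]]]; first by exists [::], a, p.
by exists (a :: p1), c, p2.
Qed.

Lemma walk_backtrack E s t p1 a p2 :
  walk E s (p1 ++ a :: einv a :: p2) t -> walk E s (p1 ++ p2) t.
Proof.
case/walk_cat=> r wp1 /= /and5P[_ /eqP ar _ _].
by rewrite ter_einv ar; apply: cat_walk.
Qed.

Lemma backtrack_free_walk E s t p : walk E s p t ->
  exists2 q, walk E s q t & backtrack_free q.
Proof.
have [n] := ubnP (size p); elim: n p => // n IHn p /ltnSE pn wp.
have [bp|/backtrackP[p1 [a [p2 defp]]]] := boolP (backtrack_free p); first by exists p.
apply: (IHn (p1 ++ p2)); last by apply: (@walk_backtrack _ _ _ _ a); rewrite -defp.
by apply: leq_trans pn; rewrite defp !size_cat /= !addnS ltnS leqnSn.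
Qed.

Lemma edge_leaving (A : {set vertex X}) s t p :
  walk [set: edge X]%SET s p t -> s \in A -> t \notin A ->
  exists2 a, org a \in A & ter a \notin A.
Proof.
elim: p s => [|a p IHp] s /=; first by move=> /eqP-> ->.
case/and3P=> _ /eqP <- wp aA tA.
have [aA'|] := boolP (ter a \in A); last by exists a.
exact: IHp wp aA' tA.
Qed.

End Walks.

Section MaximalTree.
Variables (X : graph) (T : subgraph X).
Hypothesis connX : connected_graph X.
Hypothesis maxT : is_maximal_tree T.
Implicit Types (a b : edge X) (s t r : vertex X) (p q : seq (edge X)).

Lemma sg_ter (Y : subgraph X) a : a \in sg_edge Y -> ter a \in sg_vertex Y.
Proof. by move=> aY; rewrite -org_einv; apply/sg_org/sg_einv. Qed.

(** If a maximal tree missed a vertex, some edge [a] would leave it, and [a]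
    with its end point could be added: the end point is a leaf, so a walk
    without backtracking can visit it only at its own ends. *)
Section AddLeaf.
Variable a : edge X.
Hypotheses (aT : org a \in sg_vertex T) (aNT : ter a \notin sg_vertex T).

Let V := (ter a |: sg_vertex T)%SET.
Let E := ([set a; einv a] :|: sg_edge T)%SET.

Lemma leaf_einv b : b \in E -> einv b \in E.
Proof.
rewrite !inE => /orP[/orP[]/eqP->|/sg_einv->]; rewrite ?einvK ?eqxx ?orbT //.
Qed.

Lemma leaf_org b : b \in E -> org b \in V.
Proof.
rewrite !inE => /orP[/orP[]/eqP->|/sg_org->]; rewrite ?org_einv ?aT ?eqxx ?orbT //.
Qed.

Definition add_leaf := Subgraph leaf_einv leaf_org.

Let org_neq : org a != ter a.
Proof. by apply: contraNneq aNT => <-. Qed.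

Lemma leaf_walk_avoid s t p : walk E s p t -> backtrack_free p ->
  s != ter a -> t != ter a -> walk (sg_edge T) s p t.
Proof.
elim: p s => [//|b p IHp] s /= /and3P[bE bs wp] bp sNa tNa; rewrite bs /=.
have bp' : backtrack_free p by apply: path_sorted bp.
move: bE; rewrite !inE => /orP[/orP[/eqP eb|/eqP eb]|bT]; last first.
- rewrite bT (IHp (ter b)) //; apply: contraNneq aNT => <-; exact: sg_ter.
- by move: bs sNa; rewrite eb org_einv eq_sym => ->.
case: p wp bp {IHp bp'} => [|c p]; first by rewrite /= eb eq_sym (negbTE tNa).
rewrite eb /= !inE => /and3P[/orP[/orP[]/eqP ec|cT] ce _] /andP[bc _].
- by rewrite ec (negbTE org_neq) in ce.
- by rewrite ec eqxx in bc.
- by move: aNT; rewrite -(eqP ce) sg_org.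
Qed.

Lemma add_leaf_tree : is_tree add_leaf.
Proof.
have [[[s0 s0T] connT acycT] _] := maxT.
have subE : {subset sg_edge T <= E} by move=> b bT; rewrite !inE bT orbT.
have to_org s : s \in V -> exists p, walk E s p (org a).
  rewrite !inE => /orP[/eqP->|sT].
    by exists [:: einv a]; rewrite /= org_einv ter_einv !inE !eqxx orbT.
  by have [p /(walk_sub subE)] := connT _ _ sT aT; exists p.
split=> [|s t sV tV|s p wp bp].
- by exists s0; rewrite !inE s0T orbT.
- have [p wp] := to_org _ sV; have [q wq] := to_org _ tV.
  exists (p ++ rev_walk q); apply: cat_walk wp _.
  exact: walk_rev leaf_einv wq.
have [sa|sNa] := eqVneq s (ter a); last first.
  by apply: acycT (leaf_walk_avoid wp bp sNa sNa) bp.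
case: p wp bp => [//|b p] /= /and3P[bE bs wp] bp.
have eb : b = einv a.
  move: bE; rewrite !inE => /orP[/orP[]/eqP//|bT].
    by move=> eb; move: bs org_neq; rewrite eb -sa => ->.
  by move: aNT; rewrite -sa -(eqP bs) sg_org.
rewrite eb ter_einv in wp.
case/lastP: p wp bp => [|p c]; first by rewrite /= sa (negbTE org_neq).
rewrite -cats1 => /walk_cat[r wp] /= /and3P[cE /eqP cr /eqP cs] bp.
have ec : c = a.
  move: cE; rewrite !inE => /orP[/orP[]/eqP//|cT].
    by move=> ec; move: cs org_neq; rewrite ec ter_einv -sa => ->; rewrite eqxx.
  by move: aNT; rewrite -sa -cs sg_ter.
rewrite -cr ec in wp.
have bpp : backtrack_free p by move: bp; rewrite cat_path => /andP[/path_sorted].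
have /acycT/(_ bpp) p0 := leaf_walk_avoid wp bpp org_neq org_neq.
by move: bp; rewrite p0 eb ec /= einvK eqxx.
Qed.

End AddLeaf.

Lemma maximal_tree_spans s : s \in sg_vertex T.
Proof.
have [[[s0 s0T] _ _] maxTY] := maxT.
have [_ /(_ s0 s)[p wp]] := connX.
apply/negPn/negP => /(edge_leaving wp s0T)[a aT aNT].
have /fintype.subsetP/(_ (ter a)) : sg_vertex (add_leaf aT) \subset sg_vertex T.
  have [] // := maxTY _ (add_leaf_tree aT aNT).
  by split; apply/fintype.subsetP => x xT; rewrite !inE xT orbT.
by rewrite !inE eqxx (negbTE aNT) => /(_ isT).
Qed.

Lemma maximal_tree_walk s t : exists p, walk (sg_edge T) s p t.
Proof. by have [[_ connT _] _] := maxT; apply: connT; apply: maximal_tree_spans. Qed.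

(** A closed walk in a tree backtracks, so a map that is multiplicative along
    walks and sends opposite edges to inverse elements kills it. *)
Lemma closed_walk_trivial (K : groupType) (theta : edge X -> K) s p :
  (forall a, theta (einv a) = (theta a)^-1) ->
  walk (sg_edge T) s p s -> \prod_(a <- p) theta a = 1.
Proof.
move=> thetaV; have [n] := ubnP (size p).
elim: n p => // n IHn p /ltnSE pn wp.
have [bp|/backtrackP[p1 [a [p2 defp]]]] := boolP (backtrack_free p).
  by have [[_ _ acyc] _] := maxT; rewrite (acyc _ _ wp bp) big_nil.
rewrite defp big_cat !big_cons thetaV /= mulVKg -big_cat.
apply: IHn; last by apply: (@walk_backtrack _ _ _ _ _ a); rewrite -defp.
by apply: leq_trans pn; rewrite defp !size_cat /= !addnS ltnS leqnSn.
Qed.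

Lemma prod_rev_walk (K : groupType) (theta : edge X -> K) p :
  (forall a, theta (einv a) = (theta a)^-1) ->
  \prod_(a <- rev_walk p) theta a = (\prod_(a <- p) theta a)^-1.
Proof.
move=> thetaV; elim: p => [|a p IHp]; first by rewrite !big_nil invg1.
by rewrite /rev_walk /= rev_cons -cats1 big_cat big_seq1 big_cons IHp invgM thetaV.
Qed.

End MaximalTree.

(** * Homomorphisms out of the fundamental group *)

Section Presentation.
Variable G : decomposed_gog.
Local Notation Gamma := (pi1 G).
Implicit Types (a : edge G) (s : vertex G) (v w : word G).

Lemma pi1_of_word_cat v w : pi1_of_word (v ++ w) = pi1_of_word v * pi1_of_word w.
Proof. by apply/pi1_eqP/weq_sym/weq_cat; apply: repr_word_eq. Qed.

Lemma pi1_word_ind (P : Gamma -> Prop) :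
  (forall w, P (pi1_of_word w)) -> forall x, P x.
Proof. by move=> Pw x; rewrite -(pi1_of_word_repr x). Qed.

Definition tedge a : Gamma := pi1_of_word [:: lt a true].

Lemma tedgeV_word a : pi1_of_word [:: lt a false] = (tedge a)^-1.
Proof.
apply/esym/mulg1_eq; rewrite -pi1_of_word_cat; apply/pi1_eqP.
exact: (weq_cancel a true).
Qed.

Lemma tedge_einv a : tedge (einv a) = (tedge a)^-1.
Proof. by rewrite -tedgeV_word; apply/pi1_eqP/weq_einv. Qed.

Lemma tedge_tree a : a \in sg_edge (mtree G) -> tedge a = 1.
Proof. by move=> aT; apply/pi1_eqP/weq_tree. Qed.

Lemma vinclM s : {morph @vincl G s : g h / g * h}.
Proof.
by move=> g h; rewrite -pi1_of_word_cat; apply/pi1_eqP/weq_sym/weq_mul.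
Qed.

Lemma vincl1 s : @vincl G s 1 = 1.
Proof. by apply/pi1_eqP/weq_one. Qed.

Lemma vincl_edge (b : {b : edge G | b \in pos_edge G}) (h : egroup b) :
  vincl (emb_org b h) * tedge (val b) = tedge (val b) * vincl (emb_ter b h).
Proof.
have := weq_edge h => /pi1_eqP; rewrite -/(vincl _) => ->.
rewrite (pi1_of_word_cat [:: _]) (pi1_of_word_cat [:: _] [:: _]) -/(tedge _) tedgeV_word.
by rewrite -!mulgA mulVg mulg1.
Qed.

(** A family of homomorphisms [eta] on the vertex groups and stable letters
    [theta] that satisfy the edge relations does not define a homomorphism on
    [Gamma], since [theta a] need not be [1] on the tree.  Conjugating by
    transport elements [tau s] along the tree repairs this. *)
Section Lift.
Variables (K : groupType) (eta : forall s, vgroup s -> K) (theta : edge G -> K).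
Hypothesis etaM : forall s, {morph @eta s : g h / g * h}.
Hypothesis thetaV : forall a, theta (einv a) = (theta a)^-1.
Hypothesis eta_edge : forall (b : {b : edge G | b \in pos_edge G}) (h : egroup b),
  eta (emb_org b h) * theta (val b) = theta (val b) * eta (emb_ter b h).

Let eta1 s : eta (1 : vgroup s) = 1.
Proof. by apply: (mulgI (eta (1 : vgroup s))); rewrite -etaM !mulg1. Qed.

Section Transport.
Variable tau : vertex G -> K.
Hypothesis tau_tree : forall a, a \in sg_edge (mtree G) ->
  tau (org a) * theta a = tau (ter a).

Definition letter_lift (x : letter G) : K :=
  match x with
  | inl g => tau (tag g) * eta (tagged g) * (tau (tag g))^-1
  | inr (a, b) => let k := tau (org a) * theta a * (tau (ter a))^-1 in
      if b then k else k^-1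
  end.

Lemma letter_lift_edge a b :
  letter_lift (lt a b) = let k := tau (org a) * theta a * (tau (ter a))^-1 in
      if b then k else k^-1.
Proof. by []. Qed.

Lemma letter_lift_vertex s (g : vgroup s) :
  letter_lift (lv g) = tau s * eta g * (tau s)^-1.
Proof. by []. Qed.

Lemma word_lift_eq v w : word_eq v w ->
  \prod_(x <- v) letter_lift x = \prod_(x <- w) letter_lift x.
Proof.
elim=> {v w} //.
- by move=> u v w _ -> _ ->.
- by move=> v v' w w' _ vv' _ ww'; rewrite !big_cat /= vv' ww'.
- by move=> s; rewrite big_seq1 big_nil letter_lift_vertex eta1 mulg1 mulgV.
- move=> s g h; rewrite big_cons !big_seq1 !letter_lift_vertex etaM.
  by rewrite !mulgA mulgVK.
- move=> a b; rewrite big_cons big_seq1 big_nil !letter_lift_edge.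
  by case: b => /=; rewrite ?mulgV ?mulVg.
- move=> b h; rewrite !big_cons !big_nil mulg1 !letter_lift_edge !letter_lift_vertex /=.
  rewrite !invgM !invgK !mulgA !mulgVK -[_ * theta _ * _]mulgA -eta_edge.
  by rewrite !mulgA mulg1 mulgK.
- move=> a; rewrite !big_seq1 !letter_lift_edge /= thetaV org_einv ter_einv.
  by rewrite !invgM invgK mulgA.
- move=> a aT; rewrite big_seq1 big_nil letter_lift_edge /= tau_tree //.
  exact: mulgV.
Qed.

End Transport.

(** [tau s] is the product of the stable letters along any tree walk from a base
    vertex to [s]; its value does not depend on the walk because closed walks in
    the tree act trivially. *)
Theorem pi1_lift : exists (Phi : Gamma -> K) (tau : vertex G -> K),
  [/\ {morph Phi : x y / x * y},
      forall s (g : vgroup s), Phi (vincl g) = tau s * eta g * (tau s)^-1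
    & forall a, Phi (tedge a) = tau (org a) * theta a * (tau (ter a))^-1].
Proof.
have treeG := mtreeP G; have connG := gog_connected G.
have [s0 _] := connG.1.
have [path_to path_toP] := choice (maximal_tree_walk connG treeG s0).
pose tau s := \prod_(a <- path_to s) theta a.
have tau_tree a : a \in sg_edge (mtree G) -> tau (org a) * theta a = tau (ter a).
  move=> aT; apply: divg1_eq.
  have cw : walk (sg_edge (mtree G)) s0
      (path_to (org a) ++ a :: rev_walk (path_to (ter a))) s0.
    apply: cat_walk (path_toP _) _ => /=; rewrite aT eqxx /=.
    exact: walk_rev (@sg_einv _ _) (path_toP _).
  have := closed_walk_trivial treeG thetaV cw.
  by rewrite big_cat big_cons /= prod_rev_walk // mulgA.
exists (fun x => \prod_(l <- repr x) letter_lift tau l), tau.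
split=> [x y|s g|a].
- by rewrite (word_lift_eq tau_tree (repr_word_eq _)) big_cat.
- by rewrite (word_lift_eq tau_tree (repr_word_eq _)) big_seq1.
- by rewrite (word_lift_eq tau_tree (repr_word_eq _)) big_seq1.
Qed.

End Lift.

(** * Vertex groups embed *)

Section EdgeRelation.
Variables (H : groupType) (delta : forall s, vgroup s -> H).
Hypothesis deltaM : forall s, {morph @delta s : g h / g * h}.

Definition edge_rel a (x y : H) : Prop :=
  (exists2 b : {b : edge G | b \in pos_edge G}, val b = a &
     exists h : egroup b, x = delta (emb_org b h) /\ y = delta (emb_ter b h)) \/
  (exists2 b : {b : edge G | b \in pos_edge G}, val b = einv a &
     exists h : egroup b, x = delta (emb_ter b h) /\ y = delta (emb_org b h)).

Hypothesis edge_rel_fun : forall a x y y', edge_rel a x y -> edge_rel a x y' -> y = y'.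

Lemma pos_edge_einv a : a \in pos_edge G -> einv a \notin pos_edge G.
Proof. by have := @pos_edgeP G a; do 2!case: (_ \in _). Qed.

(** An edge is positive or opposite to a positive one, never both, so one of
    the two clauses of [edge_rel] is empty and [edge_rel a] is the image of one
    homomorphism into [H * H]. *)
Lemma edge_relP a : exists (L : groupType) (f g : L -> H),
  [/\ {morph f : x y / x * y}, {morph g : x y / x * y} &
      forall x y, edge_rel a x y <-> exists l, x = f l /\ y = g l].
Proof.
have [apos|aneg] := boolP (a \in pos_edge G).
  pose b : {b : edge G | b \in pos_edge G} := Sub a apos.
  exists (egroup b), (fun h => delta (emb_org b h)), (fun h => delta (emb_ter b h)).
  split=> [x y|x y|x y]; rewrite ?gmulfM ?deltaM //; split=> [[][c cE ch]|bh].
  - by have -> : b = c by apply: val_inj.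
  - by have := pos_edge_einv apos; rewrite -cE (valP c).
  - by left; exists b.
have apos : einv a \in pos_edge G.
  by have := @pos_edgeP G a; rewrite (negbTE aneg).
pose b : {b : edge G | b \in pos_edge G} := Sub (einv a) apos.
exists (egroup b), (fun h => delta (emb_ter b h)), (fun h => delta (emb_org b h)).
split=> [x y|x y|x y]; rewrite ?gmulfM ?deltaM //; split=> [[][c cE ch]|bh].
- by move: aneg; rewrite -cE (valP c).
- by have -> : b = c by apply: val_inj.
- by right; exists b.
Qed.

Lemma edge_rel_piso : partial_isos (@einv G) edge_rel.
Proof.
have morph1 (L : groupType) (f : L -> H) : {morph f : x y / x * y} -> f 1 = 1.
  by move=> fM; apply: (mulgI (f 1)); rewrite -fM !mulg1.
split=> //; first exact: einvK.
- move=> a x y [][b bE [h [-> ->]]].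
    by right; exists b; [rewrite einvK | exists h].
  by left; exists b => //; exists h.
- move=> a; have [L [f [g [fM gM relE]]]] := edge_relP a.
  by apply/relE; exists 1; rewrite !morph1.
- move=> a x y x' y'; have [L [f [g [fM gM relE]]]] := edge_relP a.
  by move=> /relE[l [-> ->]] /relE[l' [-> ->]]; apply/relE; exists (l * l').
- move=> a x y; have [L [f [g [fM gM relE]]]] := edge_relP a.
  move=> /relE[l [-> ->]]; apply/relE; exists l^-1.
  by split; apply: mulg1_eq; rewrite -?fM -?gM mulgV morph1.
Qed.

(** The maps [eta] and [theta] are the base group and the stable letters of the
    HNN extension of [H] along the relations [edge_rel], inside the group [K] of
    bijections of its normal forms. *)
Theorem pi1_to_hnn :
  exists (K : groupType) (eta : H -> K) (theta : edge G -> K)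
         (Phi : Gamma -> K) (tau : vertex G -> K),
  [/\ [/\ {morph Phi : x y / x * y},
      forall s (g : vgroup s), Phi (vincl g) = tau s * eta (delta g) * (tau s)^-1
    & forall a, Phi (tedge a) = tau (org a) * theta a * (tau (ter a))^-1],
   {morph eta : x y / x * y} &
   forall u p q, reduced (@einv G) edge_rel p -> reduced (@einv G) edge_rel q ->
     eta u * path_val eta theta p = path_val eta theta q -> ladder edge_rel u p q].
Proof.
pose eta := hnn_base edge_rel_piso; pose theta := hnn_stable edge_rel_piso.
have etaM : {morph eta : x y / x * y} by apply: hnn_baseM.
have [s|a|b h|Phi [tau [PhiM Phi_v Phi_t]]] :=
    @pi1_lift _ (fun s g => eta (delta g)) theta.
- by move=> g h; rewrite deltaM etaM.
- exact: hnn_stableV.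
- by apply: hnn_relation; left; exists b => //; exists h.
exists _, eta, theta, Phi, tau; split=> // u p q.
exact: hnn_ladder.
Qed.

End EdgeRelation.

(** In the product of the vertex groups the edge relations are graphs of
    injective maps, because the edge monomorphisms are injective. *)
Lemma vincl_inj s : injective (@vincl G s).
Proof.
pose delta s := @product_incl (vertex G) (@vgroup G) s.
have delta_inj t : injective (@delta t) by apply: product_incl_inj.
have deltaM t : {morph @delta t : g h / g * h} by apply: product_inclM.
have [a x y y'|K [eta [theta [Phi [tau [[PhiM Phi_v Phi_t] etaM lad]]]]]] :=
    pi1_to_hnn deltaM.
  case=> [][b bE [h [-> ->]]] [][c cE [k]].
  - have ebc : b = c by apply: val_inj; rewrite bE cE.
    by case: c / ebc k cE => k _ [/delta_inj/emb_org_inj-> ->].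
  - by case/negP: (pos_edge_einv (valP b)); rewrite [val b]bE -[einv a]cE (valP c).
  - by case/negP: (pos_edge_einv (valP c)); rewrite [val c]cE -[einv a]bE (valP b).
  - have ebc : b = c by apply: val_inj; rewrite bE cE.
    by case: c / ebc k cE => k _ [/delta_inj/emb_ter_inj-> ->].
move=> g h /(congr1 Phi); rewrite !Phi_v => /mulIg/mulgI eq_gh.
have := lad (delta s g) (PEnd 1) (PEnd (delta s h)) I I.
rewrite /= -etaM mulg1 => /(_ eq_gh); exact: delta_inj.
Qed.

End Presentation.

(** * Reduced expressions in the fundamental group *)

Section ReducedExpressions.
Variable G : decomposed_gog.
Local Notation Gamma := (pi1 G).
Local Notation path := (path_word Gamma (edge G)).
Local Notation gval := (path_val id (@tedge G)).
Local Notation greduced := (reduced (@einv G) (@edge_iso G)).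
Implicit Types (a b : edge G) (s t r : vertex G) (p q : path) (x y z u : Gamma).

(** The expression follows a path of the graph from [s] to [t], its elements
    being taken in the vertex groups met on the way. *)
Fixpoint path_from s p t : Prop :=
  match p with
  | PEnd g => s = t /\ vsubgroup s g
  | PStep h a q => [/\ org a = s, vsubgroup s h & path_from (ter a) q t]
  end.

Lemma vsubgroup1 s : vsubgroup s (1 : Gamma).
Proof. by exists 1; rewrite ?vincl1. Qed.

Lemma vsubgroupM s x y : vsubgroup s x -> vsubgroup s y -> vsubgroup s (x * y).
Proof. by move=> [g _ <-] [h _ <-]; exists (g * h); rewrite ?vinclM. Qed.

Lemma edge_iso_tedge a x y : edge_iso a x y -> x * tedge a = tedge a * y.
Proof.
case=> [][b bE [h [-> ->]]]; first by rewrite -bE vincl_edge.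
rewrite -[a]einvK -bE tedge_einv; apply: (mulgI (tedge (val b))).
by rewrite mulVKg mulgA -vincl_edge mulgK.
Qed.

Lemma edge_iso_vsubgroup a x y : edge_iso a x y ->
  vsubgroup (org a) x /\ vsubgroup (ter a) y.
Proof.
case=> [][b bE [h [-> ->]]]; first by rewrite -bE; split; apply: imageT.
by rewrite -[a]einvK -bE org_einv ter_einv; split; apply: imageT.
Qed.

Lemma edge_iso_fun a x y y' : edge_iso a x y -> edge_iso a x y' -> y = y'.
Proof. by move=> /edge_iso_tedge xy /edge_iso_tedge; rewrite xy => /mulgI. Qed.

Lemma edge_iso_piso : partial_isos (@einv G) (@edge_iso G).
Proof. exact: edge_rel_piso (@vinclM G) edge_iso_fun. Qed.

Definition has_path s t z :=
  exists p, [/\ path_from s p t, greduced p & gval p = z].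

Lemma has_path1 s : has_path s s 1.
Proof. by exists (PEnd 1); split=> //; split=> //; apply: vsubgroup1. Qed.

Lemma has_path_mul s t h z : vsubgroup s h -> has_path s t z -> has_path s t (h * z).
Proof.
move=> sh [[g|k a q] [/= pf rp <-]].
  by exists (PEnd (h * g)); split=> //=; case: pf => <- sg; split=> //; apply: vsubgroupM.
exists (PStep (h * k) a q); split; rewrite /= ?mulgA //.
by case: pf => ? sk ?; split=> //; apply: vsubgroupM.
Qed.

(** If prefixing [t_a] destroys reducedness, then the expression starts with
    [h t_(-a)] where [t_a h t_(-a)] is in the vertex group at the origin of [a],
    and is absorbed in the next element. *)
Lemma has_path_tedge a t z : has_path (ter a) t z -> has_path (org a) t (tedge a * z).
Proof.
move=> [p [pf rp <-]]; have [nc|] := pselect (no_cancel (@einv G) (@edge_iso G) a p).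
  exists (PStep 1 a p); split=> //=; last by rewrite mul1g.
  by split=> //; apply: vsubgroup1.
case: p pf rp => [//|h b q] /= [bo sh qf] [_ rq] /contrapT[bE [k hk]].
rewrite !mulgA -[tedge a * h * _]mulgA (edge_iso_tedge hk) bE tedge_einv mulVKg.
apply: has_path_mul; last by exists q; split=> //; rewrite -ter_einv -bE.
by rewrite -ter_einv -bE; have [] := edge_iso_vsubgroup hk.
Qed.

Lemma has_path_tree s s' t z w : walk (sg_edge (mtree G)) s w s' ->
  has_path s' t z -> has_path s t z.
Proof.
elim: w s => [|a w IHw] s /=; first by move=> /eqP->.
case/and3P=> aT /eqP <- ww /(IHw _ ww)/has_path_tedge.
by rewrite tedge_tree // mul1g.
Qed.

(** The letters of a word need not follow a path, but [t_a = 1] on the maximal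
    tree, so one can move freely between vertices before each letter. *)
Theorem closed_path_exists s z : has_path s s z.
Proof.
have move_to t t' z' : has_path t' s z' -> has_path t s z'.
  have [w] := maximal_tree_walk (gog_connected G) (mtreeP G) t t'.
  exact: has_path_tree.
elim/pi1_word_ind: z => w; elim: w => [|x w IHw]; first exact: has_path1.
rewrite (pi1_of_word_cat [:: x]).
case: x => [[s' g]|[a []]].
- apply: (move_to _ s'); apply: has_path_mul (move_to _ _ _ IHw).
  exact: imageT.
- by apply: (move_to _ (org a)); apply: has_path_tedge (move_to _ _ _ IHw).
- rewrite tedgeV_word -tedge_einv; apply: (move_to _ (org (einv a))).
  exact: has_path_tedge (move_to _ _ _ IHw).
Qed.

(** The base group of the HNN extension is [Gamma] itself: conjugation by
    [tedge a] makes each [edge_iso a] the graph of an isomorphism.  Evaluating a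
    path expression in the extension multiplies its value by [tau s] and
    [(tau t)^-1], which are the same on both sides and cancel. *)
Theorem pi1_ladder s t u p q : path_from s p t -> path_from s q t ->
  greduced p -> greduced q -> vsubgroup s u ->
  u * gval p = gval q -> ladder (@edge_iso G) u p q.
Proof.
move=> pf qf rp rq su upq.
have [K [eta [theta [Phi [tau [[PhiM Phi_v Phi_t] etaM lad]]]]]] :=
  pi1_to_hnn (@vinclM G) edge_iso_fun.
have Phi_vsub r x : vsubgroup r x -> Phi x = tau r * eta x * (tau r)^-1.
  by move=> [g _ <-].
have Phi_val r p' : path_from r p' t ->
    Phi (gval p') = tau r * path_val eta theta p' * (tau t)^-1.
  elim: p' r => [g|h a p' IHp] r /=; first by case=> <-; apply: Phi_vsub.
  case=> <- rh /IHp pE; rewrite !PhiM pE Phi_t (Phi_vsub _ _ rh).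
  by rewrite !mulgA !mulgVK.
apply: lad => //; move/(congr1 Phi): upq.
rewrite PhiM (Phi_val _ _ pf) (Phi_val _ _ qf) (Phi_vsub _ _ su) !mulgA mulgVK.
by move=> /mulIg; rewrite -!mulgA => /mulgI.
Qed.

Fixpoint path_edges p : seq (edge G) :=
  if p is PStep _ a q then a :: path_edges q else [::].
Fixpoint path_elements p : seq Gamma :=
  match p with PEnd g => [:: g] | PStep h _ q => h :: path_elements q end.

Lemma size_path_edges p : size (path_edges p) = path_size p.
Proof. by elim: p => //= h a q ->. Qed.

Lemma ladder_edges u p q : ladder (@edge_iso G) u p q -> path_edges p = path_edges q.
Proof.
elim: p u q => [g|h a p IHp] u [g'|h' b q] //= [-> [c [d [_ _ /IHp->]]]] //.
Qed.

(** * Commuting elements and circuits *)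

Fixpoint path_mulr p v : path :=
  match p with
  | PEnd g => PEnd (g * v)
  | PStep h a q => PStep h a (path_mulr q v)
  end.

Lemma path_mulr_val p v : gval (path_mulr p v) = gval p * v.
Proof. by elim: p => //= h a q ->; rewrite mulgA. Qed.

Lemma path_mulr_from s t p v : vsubgroup t v -> path_from s p t ->
  path_from s (path_mulr p v) t.
Proof.
move=> tv; elim: p s => [g|h a q IHq] s /=; last by case=> -> ? /IHq.
by case=> -> tg; split=> //; apply: vsubgroupM.
Qed.

Lemma path_mulr_reduced p v : greduced p -> greduced (path_mulr p v).
Proof.
by elim: p => //= h a q IHq [nc /IHq rq]; split=> //; case: q nc {rq IHq}.
Qed.

(** Rungs of a ladder from [p] to [p * v] are the elements [c_i^-] and [c_i^+]
    of a circuit: the two expressions having the same elements [h_i], each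
    relation [u h = h c] reads [u = h c h^-1].  Prefixing [u] to the list of the
    [c_i^+] gives all these relations one form, including the last, where [v]
    replaces [c^-]. *)
Lemma ladder_labels a0 u p v : ladder (@edge_iso G) u p (path_mulr p v) ->
  exists cs ds : seq Gamma,
  [/\ forall i, (i < path_size p)%N ->
        edge_iso (nth a0 (path_edges p) i) (nth 1 cs i) (nth 1 ds i),
      forall i, (i < path_size p)%N -> nth 1 (u :: ds) i =
        nth 1 (path_elements p) i * nth 1 cs i * (nth 1 (path_elements p) i)^-1
    & nth 1 (u :: ds) (path_size p) =
        nth 1 (path_elements p) (path_size p) * v
          * (nth 1 (path_elements p) (path_size p))^-1].
Proof.
elim: p u => [g|h a q IHq] u /=.
  by move=> ug; exists [::], [::]; split=> //=; rewrite -ug mulgK.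
move=> [_ [c [d [cd uc /IHq[cs [ds [isoP midP lastP]]]]]]].
exists (c :: cs), (d :: ds); split=> //; case=> [|i] //= lti.
- exact: isoP.
- by rewrite -uc mulgK.
- exact: midP.
Qed.

Lemma path_from_nth a0 s0 s t p : path_from s p t ->
  [/\ forall i, (i < path_size p)%N ->
        org (nth a0 (path_edges p) i) =
          nth s0 (s :: map (@ter G) (path_edges p)) i,
      forall i, (i <= path_size p)%N ->
        vsubgroup (nth s0 (s :: map (@ter G) (path_edges p)) i)
          (nth 1 (path_elements p) i)
    & nth s0 (s :: map (@ter G) (path_edges p)) (path_size p) = t].
Proof.
elim: p s => [g|h a q IHq] s /=; first by case=> -> tg; split=> // -[].
move=> [ao sh /IHq[orgP elP endP]]; split=> //; case=> [|i] //= lti.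
  exact: orgP.
exact: elP.
Qed.

Lemma reduced_nth a0 p : greduced p -> forall i, (i.+1 < path_size p)%N ->
  ~ (nth a0 (path_edges p) i.+1 = einv (nth a0 (path_edges p) i)
     /\ edge_sub_ter (nth a0 (path_edges p) i) (nth 1 (path_elements p) i.+1)).
Proof.
elim: p => [//|h a q IHq] /= [nc rq] [|i] lti; last exact: IHq.
case: q nc {IHq rq} lti => [//|k b q] nc _ [/= bE [x xk]]; apply: nc; split=> //.
by exists x; rewrite bE; exact: (piso_sym edge_iso_piso xk).
Qed.

Hypothesis Gcirc : without_circuit G.

(** As [u p = p u], there is a ladder from [p] to [p * u], whose rungs label the
    path of [p] into a circuit at [u]; it is reduced because [p] is. *)
Lemma commuting_path_trivial s u p : vsubgroup s u -> u <> 1 -> path_from s p s ->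
  greduced p -> u * gval p = gval p * u -> path_size p = 0%N.
Proof.
move=> su u1 pf rp upu; apply/eqP; apply: contrapT => /eqP p0.
case: p p0 pf rp upu => [//|h0 a0 p0]; set p := PStep h0 a0 p0 => _ pf rp upu.
have lad : ladder (@edge_iso G) u p (path_mulr p u).
  apply: (pi1_ladder pf (path_mulr_from su pf) rp (path_mulr_reduced u rp) su).
  by rewrite path_mulr_val.
have [cs [ds [isoP midP lastP]]] := ladder_labels a0 lad.
have [orgP elP endP] := path_from_nth a0 s pf.
(* The vertices of the circuit are [s] and the ends of the edges of [p]; the
   goal is its triviality, which is convertible to [path_size p = 0]. *)
pose n := path_size p.
suff : path_size p = 0%N by [].
unshelve refine (@Gcirc s u su u1 (@Circuit G s u n (fun i => nth a0 (path_edges p) i)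
    (fun i => nth s (s :: map (@ter G) (path_edges p)) i)
    (fun i => nth 1 cs i) (fun i => nth 1 ds i)
    (fun i => nth 1 (path_elements p) i) erefl endP _ _ _ _ _ _ _ _ _ _) _).
- by move=> i; apply: orgP.
- move=> i; rewrite lift0 -[RHS]/(nth s (map (@ter G) (path_edges p)) i).
  by rewrite (nth_map a0) ?size_path_edges.
- by move=> i; exists (nth 1 ds i); apply: isoP.
- by move=> i; exists (nth 1 cs i); apply: isoP.
- by move=> i; apply: isoP.
- by move=> i; apply: elP; rewrite -ltnS.
- by [].
- by move=> i i0; rewrite i0; apply: (midP 0%N).
- by move=> i j ji; rewrite ji; apply: (midP i.+1); rewrite -ji.
- by move=> i iE; rewrite -[nth 1 ds i]/(nth 1 (u :: ds) i.+1) iE; apply: lastP.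
- move=> [i [j [/= ji eij hP]]]; apply: (@reduced_nth a0 p rp i).
    by rewrite -ji.
  by split=> //; rewrite -ji.
Qed.

Theorem centralizer_in_vsubgroup s u z : vsubgroup s u -> u <> 1 ->
  commute z u -> vsubgroup s z.
Proof.
move=> su u1 zu; have [p [pf rp zE]] := closed_path_exists s z.
have := commuting_path_trivial su u1 pf rp; rewrite zE => /(_ (esym zu)).
by case: p pf zE {rp} => [g [_ sg] <-|//].
Qed.

End ReducedExpressions.

(** * Infinite cyclic groups *)

Section IntegerPowers.
Variables (K : groupType) (t : K).

Definition zpow (m : int) : K :=
  match m with Posz n => t ^+ n | Negz n => t ^- n.+1 end.

Lemma zpowS (m : int) : zpow (1 + m)%R = t * zpow m.
Proof.
case: m => [n|[|n]]; first exact: expgS.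
  by rewrite /= expg1 mulgV.
have -> : (1 + Negz n.+1)%R = Negz n.
  by rewrite !NegzE -[n.+2]add1n PoszD GRing.opprD GRing.addNKr.
by rewrite /= [t ^+ n.+2]expgSr invgM mulVKg.
Qed.

Lemma zpowD (m n : int) : zpow (m + n)%R = zpow m * zpow n.
Proof.
elim: m => [|m IHm|m IHm].
- by rewrite GRing.add0r mul1g.
- by rewrite intS -GRing.addrA !zpowS IHm mulgA.
have negS : (1 + - m.+1%:Z)%R = (- m%:Z)%R by rewrite intS GRing.opprD GRing.addNKr.
by apply: (mulgI t); rewrite mulgA -!zpowS GRing.addrA negS.
Qed.

Lemma infinite_cyclic : (forall n, t ^+ n.+1 <> 1) -> (forall x, exists m, x = zpow m) ->
  isomorphic_to_Z K.
Proof.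
move=> tfree gen; have ker m : zpow m = 1 -> m = 0%R.
  case: m => [[|n]|n] //= => [/tfree//|/eqP].
  by rewrite invg_eq1 => /eqP/tfree.
have [log logP] := choice gen.
exists zpow; last exact: zpowD.
exists log => // m; apply/esym/eqP; rewrite -GRing.subr_eq0; apply/eqP/ker.
have zN n : zpow (- n)%R = (zpow n)^-1.
  by apply/esym/mulg1_eq; rewrite -zpowD GRing.subrr.
by rewrite zpowD zN -logP mulgV.
Qed.

End IntegerPowers.

(** * The centre *)

Section Centre.
Variable G : decomposed_gog.
Hypotheses (Gmin : minimal_dgog G) (Gcirc : without_circuit G).
Local Notation Gamma := (pi1 G).
Local Notation gval := (path_val id (@tedge G)).
Local Notation greduced := (reduced (@einv G) (@edge_iso G)).
Implicit Types (a b : edge G) (s t : vertex G) (w : seq (edge G)) (u x y z : Gamma).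

Fixpoint edge_path w : path_word Gamma (edge G) :=
  if w is a :: w' then PStep 1 a (edge_path w') else PEnd 1.

Lemma edge_path_from E s t w : walk E s w t -> path_from s (edge_path w) t.
Proof.
elim: w s => [|a w IHw] s /=; first by move=> /eqP->; split=> //; apply: vsubgroup1.
by case/and3P=> _ /eqP-> /IHw; split=> //; apply: vsubgroup1.
Qed.

Lemma edge_path_reduced w : backtrack_free w -> greduced (edge_path w).
Proof.
rewrite /backtrack_free; elim: w => // a [|b w] IHw //= /andP[/eqP ba /IHw rw].
by split=> // -[].
Qed.

Lemma edge_path_val w : gval (edge_path w) = \prod_(a <- w) tedge a.
Proof.
by elim: w => [|a w IHw] /=; rewrite ?big_nil // big_cons mul1g IHw.
Qed.

Lemma path_edges_edge_path w : path_edges (edge_path w) = w.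
Proof. by elim: w => //= a w ->. Qed.

(** Along a tree edge [t_a = 1], so [G_a^-] and [G_a^+] coincide, and the
    minimality of the positive one of [a] and [-a] gives the claim for both. *)
Lemma tree_edge_proper a : a \in sg_edge (mtree G) ->
  exists2 h, vsubgroup (ter a) h & ~ edge_sub_ter a h.
Proof.
move=> aT; have isoE x y : edge_iso a x y -> x = y.
  by move=> /edge_iso_tedge; rewrite tedge_tree // mulg1 mul1g.
have proper_ex (A B : set Gamma) : (A `<` B)%classic -> exists2 h, B h & ~ A h.
  move=> [_ NBA]; apply: contrapT => nex; apply: NBA => h Bh.
  by apply: contrapT => NAh; apply: nex; exists h.
have [apos|aneg] := boolP (a \in pos_edge G).
  have [_ /proper_ex[h sh NAh]] := Gmin aT apos.
  exists h => // -[x xh]; apply: NAh; exists h.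
  by rewrite -[X in edge_iso a X](isoE _ _ xh).
have apos : einv a \in pos_edge G.
  by have := @pos_edgeP G a; rewrite (negbTE aneg).
have [/proper_ex[h sh NAh] _] := Gmin (sg_einv aT) apos.
exists h; first by rewrite -org_einv.
by move=> [x xh]; apply: NAh; exists x; apply: (piso_sym (edge_iso_piso G) xh).
Qed.

(** An edge outside the tree is followed by the way back through the tree; a
    tree edge [a] by [-a], after an element of the end of [a] outside [G_a]. *)
Lemma nontrivial_closed_path a : exists p,
  [/\ path_from (org a) p (org a), greduced p & path_size p <> 0%N].
Proof.
have [aT|aNT] := boolP (a \in sg_edge (mtree G)).
  have [h sh NAh] := tree_edge_proper aT.
  exists (PStep 1 a (PStep h (einv a) (PEnd 1))); split=> //=.
    rewrite org_einv ter_einv; split; [by []|exact: vsubgroup1|].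
    by split=> //; split=> //; apply: vsubgroup1.
  split=> // -[_ [x hx]]; apply: NAh; exists x.
  by have := piso_sym (edge_iso_piso G) hx; rewrite einvK.
have [w0 /backtrack_free_walk[w wT bw]] :=
  maximal_tree_walk (gog_connected G) (mtreeP G) (ter a) (org a).
exists (edge_path (a :: w)); split=> //.
  by split=> //; [apply: vsubgroup1|apply: edge_path_from wT].
apply: edge_path_reduced; case: w wT bw => [//|b w] /= /andP[bT _] bw.
rewrite /backtrack_free /= bw andbT; apply: contraNneq aNT => ba.
by rewrite -[a]einvK -ba sg_einv.
Qed.

Lemma connected_no_edge s : (forall a, org a <> s) ->
  (forall s', s' = s) /\ #|edge G| = 0%N.
Proof.
move=> noE; have allE s' : s' = s.
  have [_ /(_ s s')[[|a w]]] := gog_connected G; first by move=> /eqP.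
  by case/and3P=> _ /eqP/noE.
by split=> //; apply: eq_card0 => a; case: (noE a).
Qed.

(** [z] lies in [G_s] because it commutes with [u]; then everything lies in
    [G_s] because it commutes with [z], and a nonempty reduced closed path at [s]
    would give a circuit at [z]. *)
Lemma centre_nontrivial_vertex s u z : vsubgroup s u -> u <> 1 ->
  center Gamma z -> z <> 1 ->
  [/\ forall s', s' = s, #|edge G| = 0%N & vsubgroup s = [set: Gamma]%classic].
Proof.
move=> su u1 zc z1.
have sz : vsubgroup s z by apply: (centralizer_in_vsubgroup Gcirc su u1).
have [a as0|allE noE] := @connected_no_edge s.
  have [p [pf rp p0]] := nontrivial_closed_path a; rewrite as0 in pf.
  exact/p0/(commuting_path_trivial Gcirc sz z1 pf rp (zc _)).
split=> //; apply/seteqP; split=> // x _.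
exact: (centralizer_in_vsubgroup Gcirc sz z1 (commute_sym (zc x))).
Qed.

Lemma center_vincl s : vsubgroup s = [set: Gamma]%classic ->
  center Gamma = (@vincl G s @` center (vgroup s))%classic.
Proof.
move=> sT; have sP x : vsubgroup s x by rewrite sT.
apply/seteqP; split=> [z zc|_ [g gc <-] x].
  have [g _ gz] := sP z; exists g => // h; apply: vincl_inj.
  by rewrite !vinclM gz; apply: zc.
by have [h _ <-] := sP x; rewrite /commute -!vinclM gc.
Qed.

Section TrivialVertexGroups.
Hypothesis trivG : forall s u, vsubgroup s u -> u = 1.

Lemma trivial_no_tree_edge a : a \notin sg_edge (mtree G).
Proof.
apply/negP => /tree_edge_proper[h /trivG-> []].
by exists 1; apply: piso_one (edge_iso_piso G) _.
Qed.

Lemma trivial_one_vertex s t : s = t.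
Proof.
have [[|a w]] := maximal_tree_walk (gog_connected G) (mtreeP G) s t.
  by move=> /eqP.
by rewrite /= (negbTE (trivial_no_tree_edge a)).
Qed.

Lemma trivial_walk s t w : walk [set: edge G]%SET s w t.
Proof.
elim: w s => [|a w IHw] s /=; first by rewrite (trivial_one_vertex s t).
by rewrite inE (trivial_one_vertex (org a) s) eqxx IHw.
Qed.

(** All elements of an expression being [1], it is reduced exactly when its
    path does not backtrack: [Gamma] is free on the non-oriented edges. *)
Lemma free_expression x : exists2 w, backtrack_free w & x = \prod_(a <- w) tedge a.
Proof.
have [s _] := (gog_connected G).1.
have [p [pf rp <-]] := closed_path_exists s x.
have pE : p = edge_path (path_edges p).
  have [t] : exists t, path_from t p s by exists s.
  elim: p {pf rp} t => [g|h a p IHp] t /=; first by case=> _ /trivG->.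
  by case=> _ /trivG-> /IHp <-.
exists (path_edges p); last by rewrite -edge_path_val -pE.
move: rp; rewrite pE path_edges_edge_path; elim: (path_edges p) => // a w IHw.
rewrite /backtrack_free /=; case: w IHw => //= b w IHw [nc /IHw bw].
rewrite bw andbT; apply/eqP => ba; apply: nc; split=> //.
exact: edge_dom1 (edge_iso_piso G) _.
Qed.

Lemma free_expression_unique w w' : backtrack_free w -> backtrack_free w' ->
  \prod_(a <- w) tedge a = \prod_(a <- w') tedge a -> w = w'.
Proof.
have [s _] := (gog_connected G).1.
move=> bw bw'; rewrite -!edge_path_val => eq_ww'.
rewrite -[w]path_edges_edge_path -[w']path_edges_edge_path.
apply: (@ladder_edges _ 1); apply: (@pi1_ladder _ s s).
- exact: edge_path_from (trivial_walk _ _ _).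
- exact: edge_path_from (trivial_walk _ _ _).
- exact: edge_path_reduced.
- exact: edge_path_reduced.
- exact: vsubgroup1.
- by rewrite mul1g.
Qed.

Lemma trivial_vgroup s (g : vgroup s) : g = 1.
Proof. by apply: (@vincl_inj G); rewrite vincl1; apply: trivG; apply: imageT. Qed.

Lemma no_edge_trivial x : #|edge G| = 0%N -> x = 1.
Proof.
move=> E0; have [[|a w] _ ->] := free_expression x; first by rewrite big_nil.
by have := card0_eq E0 a; rewrite inE.
Qed.

(** A central element [z], written without backtracking with first edge [a] and
    last edge [c], commutes with [t_b] for an edge [b] outside [{a, -a, -c}];
    both [b z] and [z b] are then free of backtracking, so they must be equal as
    words, which forces [b = a].  Such a [b] exists as soon as there is an edge
    other than [a] and [-a], for one can exchange it with its opposite. *)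
Lemma free_centre a0 a1 z : a1 != a0 -> a1 != einv a0 -> center Gamma z -> z = 1.
Proof.
move=> a10 a10' zc; have [w bw zE] := free_expression z.
case: w bw zE => [|a w] bw zE; first by rewrite zE big_nil.
have [b [ba baV bl]] : exists b, [/\ b != a, b != einv a & b != einv (last a w)].
  (* [c] is an edge other than [a] and [-a]; one of [c], [-c] differs from the
     opposite of the last edge. *)
  have [c [ca caV]] : exists c, c != a /\ c != einv a.
    have [a0a|a0Na] := eqVneq a0 a; first by exists a1; rewrite -a0a.
    have [a0V|] := eqVneq a0 (einv a); last by exists a0.
    by exists a1; split; move: a10 a10'; rewrite a0V ?einvK.
  have [cl|] := eqVneq c (einv (last a w)); last by exists c.
  exists (einv c); split.
  - by rewrite -(inj_eq (inv_inj (@einvK G))) einvK.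
  - by rewrite (inj_eq (inv_inj (@einvK G))).
  - by rewrite -cl einv_neq.
have : b :: a :: w = rcons (a :: w) b.
  apply: free_expression_unique; rewrite /backtrack_free /= in bw *.
  - by rewrite bw andbT; apply: contraNneq baV => ->; rewrite einvK.
  - by rewrite rcons_path bw.
  - rewrite big_cons -rcons_cons -cats1 big_cat big_seq1 -zE.
    exact: (commute_sym (zc _)).
by move=> [ab _]; rewrite ab eqxx in ba.
Qed.

Lemma cyclic_case a0 : (forall a, a = a0 \/ a = einv a0) -> isomorphic_to_Z Gamma.
Proof.
move=> Ea0; apply: (@infinite_cyclic _ (tedge a0)) => [n|x].
  have powE m : \prod_(a <- nseq m a0) tedge a = tedge a0 ^+ m.
    by elim: m => [|m IHm]; rewrite ?big_nil //= big_cons IHm expgS.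
  have bn : backtrack_free (nseq n.+1 a0).
    by elim: n => // n IHn; apply/andP; split=> //; rewrite eq_sym einv_neq.
  rewrite -powE => n1; have := free_expression_unique bn (isT : backtrack_free [::]).
  by rewrite n1 big_nil => /(_ erefl).
have [w _ ->] := free_expression x.
elim: w => [|a w [m IHw]]; first by exists 0%R; rewrite big_nil.
rewrite big_cons IHw; case: (Ea0 a) => ->; first by exists (1 + m)%R; rewrite zpowS.
by exists (- 1 + m)%R; rewrite tedge_einv zpowD /= expg1.
Qed.

End TrivialVertexGroups.

End Centre.

Theorem mainTheorem9 (G : decomposed_gog)
    (Gmin : minimal_dgog G) (Gcirc : without_circuit G) :
  (center (pi1 G) = [set 1%g])%classic
  \/ (exists s : vertex G,
        [/\ forall s' : vertex G, s' = s,
            #|edge G| = 0%N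
          & (center (pi1 G) = @vincl G s @` center (vgroup s))%classic])
  \/ (exists s : vertex G,
        [/\ forall s' : vertex G, s' = s,
            #|edge G| = 2%N,
            forall g : vgroup s, g = 1%g,
            (center (pi1 G) = [set: pi1 G])%classic
          & isomorphic_to_Z (pi1 G)]).
Proof.
have [triv|/existsNP[z /not_implyP[zc z1]]] :=
  pselect (forall z, center (pi1 G) z -> z = 1).
  left; apply/seteqP; split=> [z /triv//|_ -> x].
  exact/commute_sym/commute1.
right; have [trivG|] := pselect (forall s (u : pi1 G), vsubgroup s u -> u = 1); last first.
  move=> /existsNP[s /existsNP[u /not_implyP[su u1]]]; left; exists s.
  have [allE noE sT] := centre_nontrivial_vertex Gmin Gcirc su u1 zc z1.
  by split=> //; apply: center_vincl.
right; have [s _] := (gog_connected G).1; exists s.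
have one_vertex := trivial_one_vertex Gmin trivG.
have [a0 _] : exists a0 : edge G, True.
  apply: contrapT => noE; apply: z1; apply: (no_edge_trivial trivG).
  by apply: eq_card0 => a; case: noE; exists a.
have Ea0 a : a = a0 \/ a = einv a0.
  have [|aN] := eqVneq a a0; first by left.
  have [|aNV] := eqVneq a (einv a0); first by right.
  by case: z1; apply: (free_centre Gmin trivG aN aNV).
have isoZ := cyclic_case Gmin trivG Ea0.
split=> //.
- rewrite -cardsT (_ : [set: edge G]%SET = [set a0; einv a0]%SET).
    by rewrite cards2 eq_sym einv_neq.
  by apply/setP => a; rewrite !inE; case: (Ea0 a) => ->; rewrite eqxx ?orbT.
- exact: trivial_vgroup.
- have [f [g fK gK] fD] := isoZ; apply/seteqP; split=> // x _ y.
  by rewrite -[x]gK -[y]gK /commute -!fD GRing.addrC.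
Qed.
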